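(* (1) In Case (A) (context), there is a bijection $$H\backslash\mathfrak X\simeq B_H\backslash G/P_G\simeq \coprod_{m=0}^n\ \coprod_{\substack{p,q\ge0\\ p+q\le m}}\ \coprod_{I\in\binom{[n]}{m},\ J\in\binom{[m]}{p+q}} B_{p+q}(\mathbb C)\backslash \mathrm{GL}_{p+q}(\mathbb C)/\mathrm U(p,q).$$ (2) In Case (B) (context), there is a bijection $$H\backslash\mathfrak X\simeq B_H\backslash G/P_G\simeq \coprod_{m=0}^n\ \coprod_{\substack{p,q\ge0\\ p+q\le m}}\ \coprod_{I\in\binom{[n]}{m},\ J\in\binom{[m]}{p+q}} B_{p+q}(\mathbb R)\backslash \mathrm{GL}_{p+q}(\mathbb R)/\mathrm O(p,q).$$
   Context: Case (A): $G=\mathrm U(n,n)=\{g\in\mathrm{GL}_{2n}(\mathbb C):g^*J_ng=J_n\}$ with $J_n=\sqrt{-1}\begin{pmatrix}0&\mathbf 1_n\\-\mathbf 1_n&0\end{pmatrix}$; $P_G$ the stabilizer in $G$ of $\mathbb C^n\oplus0$ (Siegel parabolic); $H=\{\mathrm{diag}(a,(a^* )^{-1}):a\in\mathrm{GL}_n(\mathbb C)\}$; $B_H=\{\mathrm{diag}(b,(b^* )^{-1}): b \text{ upper triangular in }\mathrm{GL}_n(\mathbb C)\}$. Case (B): $G=\mathrm{Sp}_{2n}(\mathbb R)$ preserving $\Sigma_n=\begin{pmatrix}0&\mathbf 1_n\\-\mathbf 1_n&0\end{pmatrix}$; $P_G$ the stabilizer of $\mathbb R^n\oplus0$; $H=\{\mathrm{diag}(a,(a^t)^{-1}):a\in\mathrm{GL}_n(\mathbb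 R)\}$; $B_H$ the same with $a$ real upper triangular. $\mathfrak X=H/B_H\times G/P_G$ with diagonal $H$-action. $[n]=\{1,\dots,n\}$ and $\binom{[n]}{m}$ is the set of $m$-element subsets of $[n]$. $B_k(\mathbb C)$ (resp. $B_k(\mathbb R)$) is the group of invertible upper triangular $k\times k$ complex (resp. real) matrices acting by left multiplication; $\mathrm U(p,q)$ (resp. $\mathrm O(p,q)$) is the subgroup of $\mathrm{GL}_{p+q}(\mathbb C)$ (resp. $\mathrm{GL}_{p+q}(\mathbb R)$) preserving the form $\mathrm{diag}(\mathbf 1_p,-\mathbf 1_q)$, acting by right multiplication. For $p=q=0$ the summand is interpreted as a one-point set. The indices $I,J$ only record multiplicities of identical summands. *)

(* Defs.v *)
From HB Require Import structures.
From mathcomp Require Import all_boot all_order all_algebra.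
From mathcomp Require Import reals complex.
Set Implicit Arguments. Unset Strict Implicit. Unset Printing Implicit Defensive.
Import Order.TTheory GRing.Theory Num.Theory.
Local Open Scope ring_scope.

(* conjugate transpose w.r.t. a field involution c (c = conj for C, id for R) *)
Definition adjc (F : fieldType) (c : F -> F) (m k : nat) (A : 'M[F]_(m, k))
  : 'M[F]_(k, m) := (map_mx c A)^T.

Definition Sigma (F : fieldType) (n : nat) : 'M[F]_(n + n) :=
  block_mx 0 1%:M (- 1%:M) 0.

Definition inG (F : fieldType) (c : F -> F) (n : nat) (Jf : 'M[F]_(n + n))
  (g : 'M[F]_(n + n)) : Prop :=
  g \in unitmx /\ adjc c g *m Jf *m g = Jf.

Definition inP (F : fieldType) (c : F -> F) (n : nat) (Jf : 'M[F]_(n + n))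
  (g : 'M[F]_(n + n)) : Prop :=
  inG c Jf g /\
  forall v : 'cV[F]_n, exists w : 'cV[F]_n, g *m col_mx v 0 = col_mx w 0.

Definition upper_tri (F : fieldType) (k : nat) (A : 'M[F]_k) : Prop :=
  forall i j : 'I_k, (j < i)%N -> A i j = 0.

Definition inB (F : fieldType) (k : nat) (A : 'M[F]_k) : Prop :=
  A \in unitmx /\ upper_tri A.

Definition Hel (F : fieldType) (c : F -> F) (n : nat) (a : 'M[F]_n)
  : 'M[F]_(n + n) := block_mx a 0 0 (invmx (adjc c a)).

Definition inH (F : fieldType) (c : F -> F) (n : nat) (h : 'M[F]_(n + n)) : Prop :=
  exists a : 'M[F]_n, a \in unitmx /\ h = Hel c a.

Definition inBH (F : fieldType) (c : F -> F) (n : nat) (h : 'M[F]_(n + n)) : Prop :=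
  exists a : 'M[F]_n, inB a /\ h = Hel c a.

Definition Dpq (F : fieldType) (p q : nat) : 'M[F]_(p + q) :=
  block_mx 1%:M 0 0 (- 1%:M).

Definition inUpq (F : fieldType) (c : F -> F) (p q : nat) (u : 'M[F]_(p + q)) : Prop :=
  u \in unitmx /\ adjc c u *m Dpq F p q *m u = Dpq F p q.

(* H \ (H/B_H x G/P_G): a point is a pair (h, g) of coset representatives;
   (h,g) ~ (h',g') iff h' B_H = k h B_H and g' P_G = k g P_G for some k in H. *)
Definition inX (F : fieldType) (c : F -> F) (n : nat) (Jf : 'M[F]_(n + n))
  (x : 'M[F]_(n + n) * 'M[F]_(n + n)) : Prop :=
  inH c x.1 /\ inG c Jf x.2.

Definition relX (F : fieldType) (c : F -> F) (n : nat) (Jf : 'M[F]_(n + n))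
  (x x' : 'M[F]_(n + n) * 'M[F]_(n + n)) : Prop :=
  exists k b p, [/\ inH c k, inBH c b, inP c Jf p,
    x'.1 = k *m x.1 *m b & x'.2 = k *m x.2 *m p].

Definition relDC (F : fieldType) (c : F -> F) (n : nat) (Jf : 'M[F]_(n + n))
  (g g' : 'M[F]_(n + n)) : Prop :=
  exists b p, [/\ inBH c b, inP c Jf p & g' = b *m g *m p].

Definition cop (F : Type) (n : nat) : Type :=
  {t : nat * nat * nat &
     ({set 'I_n} * {set 'I_(t.1.1)} * 'M[F]_(t.1.2 + t.2))%type}.

Definition inCop (F : fieldType) (n : nat) (s : cop F n) : Prop :=
  let t := tag s in
  let m := t.1.1 in let p := t.1.2 in let q := t.2 in
  [/\ (m <= n)%N, (p + q <= m)%N,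
      #|(tagged s).1.1| = m, #|(tagged s).1.2| = (p + q)%N
    & (tagged s).2 \in unitmx].

Inductive relCop (F : fieldType) (c : F -> F) (n : nat) : cop F n -> cop F n -> Prop :=
| RelCop (m p q : nat) (I : {set 'I_n}) (J : {set 'I_m}) (x : 'M[F]_(p + q))
    (b : 'M[F]_(p + q)) (u : 'M[F]_(p + q)) :
    inB b -> inUpq c u ->
    relCop c
      (existT (fun t : nat * nat * nat =>
                 ({set 'I_n} * {set 'I_(t.1.1)} * 'M[F]_(t.1.2 + t.2))%type)
              (m, p, q) (I, J, x))
      (existT (fun t : nat * nat * nat =>
                 ({set 'I_n} * {set 'I_(t.1.1)} * 'M[F]_(t.1.2 + t.2))%type)
              (m, p, q) (I, J, b *m x *m u)).

(* A bijection between orbit sets  {x | inA x}/relA  and  {y | inB y}/relB :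
   a map on representatives that preserves carriers, induces a well defined
   injective map on classes (x ~ x' <-> f x ~ f x') and is surjective on classes. *)
Definition orbit_bij (A B : Type) (inA : A -> Prop) (relA : A -> A -> Prop)
  (inB' : B -> Prop) (relB : B -> B -> Prop) : Prop :=
  exists f : A -> B,
    [/\ forall x, inA x -> inB' (f x),
        forall x x', inA x -> inA x' -> (relA x x' <-> relB (f x) (f x'))
      & forall y, inB' y -> exists x, inA x /\ relB (f x) y].

(* Main.v *)
Require Import Defs.
From HB Require Import structures.
From mathcomp Require Import all_boot all_order all_algebra.
From mathcomp Require Import reals complex boolp zify.
Set Implicit Arguments. Unset Strict Implicit. Unset Printing Implicit Defensive.
Import Order.TTheory GRing.Theory Num.Theory.
Local Open Scope ring_scope.

(** A coset [g P_G] is a Lagrangian subspace [L] of [F^n + F^n]. It is determined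
    by its projection [W] to the second summand together with a hermitian form
    on [W], and [H] acts on [W] through the (inverse adjoint) standard
    representation. Echelon form makes [W] a coordinate subspace [F^I] by a
    unique [I] (this is the Bruhat decomposition), and the stabilizer of [F^I]
    in [B_H] acts on it through the full Borel group [B_m]. The same echelon
    reduction, applied to the Gram matrix, makes the form live on a unique
    coordinate subspace [F^K], where it is nondegenerate, hence of the form
    [x D_{p,q} x^*] for a unique signature [(p, q)] by Sylvester's law, with [x]
    unique up to [U(p, q)] on the right and [B_{p+q}] on the left. Both cases are
    treated at once, for a field with an involution [c] such that the fixed
    points of [c] are exactly the values [y c(y)] and
    [- y c(y)]. *)

(** * Algebra of the conjugate transpose *)

Section ConjugateTranspose.
Variables (F : fieldType) (c : {rmorphism F -> F}).
Hypothesis cK : involutive c.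

Lemma adjcE m k (A : 'M[F]_(m, k)) i j : adjc c A i j = c (A j i).
Proof. by rewrite !mxE. Qed.

Lemma adjcK m k (A : 'M[F]_(m, k)) : adjc c (adjc c A) = A.
Proof. by apply/matrixP=> i j; rewrite !adjcE cK. Qed.

Lemma adjcM m k l (A : 'M[F]_(m, k)) (B : 'M_(k, l)) :
  adjc c (A *m B) = adjc c B *m adjc c A.
Proof. by rewrite /adjc map_mxM trmx_mul. Qed.

Lemma adjcD m k (A B : 'M[F]_(m, k)) : adjc c (A + B) = adjc c A + adjc c B.
Proof. by rewrite /adjc map_mxD linearD. Qed.

Lemma adjcN m k (A : 'M[F]_(m, k)) : adjc c (- A) = - adjc c A.
Proof. by rewrite /adjc map_mxN linearN. Qed.

Lemma adjcB m k (A B : 'M[F]_(m, k)) : adjc c (A - B) = adjc c A - adjc c B.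
Proof. by rewrite adjcD adjcN. Qed.

Lemma adjcZ m k a (A : 'M[F]_(m, k)) : adjc c (a *: A) = c a *: adjc c A.
Proof. by apply/matrixP=> i j; rewrite !mxE rmorphM. Qed.

Lemma adjc0 m k : adjc c (0 : 'M[F]_(m, k)) = 0.
Proof. by rewrite /adjc map_mx0 trmx0. Qed.

Lemma adjc1 m : adjc c (1%:M : 'M[F]_m) = 1%:M.
Proof. by rewrite /adjc map_mx1 trmx1. Qed.

Lemma adjc_unit m (A : 'M[F]_m) : (adjc c A \in unitmx) = (A \in unitmx).
Proof. by rewrite unitmx_tr map_unitmx. Qed.

Lemma adjcV m (A : 'M[F]_m) : adjc c (invmx A) = invmx (adjc c A).
Proof. by rewrite /adjc map_invmx trmx_inv. Qed.

Lemma adjc_block m1 m2 k1 k2 (A : 'M[F]_(m1, k1)) B C (D : 'M_(m2, k2)) :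
  adjc c (block_mx A B C D) =
  block_mx (adjc c A) (adjc c C) (adjc c B) (adjc c D).
Proof. by rewrite /adjc map_block_mx tr_block_mx. Qed.

Lemma adjc_row m k1 k2 (A : 'M[F]_(m, k1)) (B : 'M_(m, k2)) :
  adjc c (row_mx A B) = col_mx (adjc c A) (adjc c B).
Proof. by rewrite /adjc map_row_mx tr_row_mx. Qed.

End ConjugateTranspose.

(** * The Borel group of upper triangular matrices *)

Section Triangular.
Variable F : fieldType.

Lemma invmxM k (A B : 'M[F]_k) : A \in unitmx -> B \in unitmx ->
  invmx (A *m B) = invmx B *m invmx A.
Proof.
move=> uA uB; have uAB : A *m B \in unitmx by rewrite unitmx_mul uA.
by rewrite -[RHS](mulKmx uAB) -!mulmxA (mulKVmx uB) mulmxV ?mulmx1.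
Qed.

Lemma inB_diag k (A : 'M[F]_k) i : inB A -> A i i != 0.
Proof.
move=> [uA tA].
have tAt : is_trig_mx A^T by apply/is_trig_mxP=> a b ab; rewrite mxE tA.
move: uA; rewrite unitmxE -det_tr (det_trig tAt) unitfE.
by move/prodf_neq0 => /(_ i isT); rewrite mxE.
Qed.

Lemma inBP k (A : 'M[F]_k) :
  upper_tri A -> (forall i, A i i != 0) -> inB A.
Proof.
move=> tA dA; split=> //.
have tAt : is_trig_mx A^T by apply/is_trig_mxP=> a b ab; rewrite mxE tA.
rewrite unitmxE -det_tr (det_trig tAt) unitfE.
by apply/prodf_neq0 => i _; rewrite mxE.
Qed.

Lemma inB1 k : inB (1%:M : 'M[F]_k).
Proof.
split=> [|i j]; first exact: unitmx1.
by rewrite mxE; case: eqP => // ->; rewrite ltnn.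
Qed.

Lemma upper_triM k (A B : 'M[F]_k) :
  upper_tri A -> upper_tri B -> upper_tri (A *m B).
Proof.
move=> tA tB i j ji; rewrite mxE big1 // => l _.
have [li|il] := ltnP l i; first by rewrite tA // mul0r.
by rewrite tB ?mulr0 // (leq_trans ji).
Qed.

Lemma inBM k (A B : 'M[F]_k) : inB A -> inB B -> inB (A *m B).
Proof.
move=> [uA tA] [uB tB]; split; last exact: upper_triM.
by rewrite unitmx_mul uA.
Qed.

(** Induction on [k - i], from the last row upwards. In entry [(i, j)] of [A *m invmx A = 1%:M] with
    [j < i], the terms [o < i] vanish by triangularity and the terms [o > i] by induction; what
    remains is the wanted entry times the nonzero [A i i]. *)
Lemma inBV k (A : 'M[F]_k) : inB A -> inB (invmx A).
Proof.
move=> BA; have [uA tA] := BA; split; first by rewrite unitmx_inv.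
move=> i j; have [l] := ubnP (k - i).
elim: l i => // l IH i il ji.
have /matrixP/(_ i j) := mulmxV uA; rewrite !mxE -val_eqE gtn_eqF //.
rewrite (bigD1 i) //= big1 ?addr0 => [/eqP|o oi].
  by rewrite mulf_eq0 (negPf (inB_diag i BA)) => /eqP.
have [lt_oi|lt_io|/val_inj eq_oi] := ltngtP o i; first by rewrite tA // mul0r.
  by rewrite IH ?mulr0 //; [have := ltn_ord o; lia | exact: ltn_trans lt_io].
by rewrite eq_oi eqxx in oi.
Qed.

End Triangular.

(** * Coordinate subspaces: projections, inclusions, compression of matrices *)

Section Coordinates.
Variable F : fieldType.

Definition coord_proj n (I : {set 'I_n}) : 'M[F]_n :=
  diag_mx (\row_i (i \in I)%:R).

(** Meaningful only when [m = #|I|]: the inclusion of [F^m] in [F^n] as the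
    coordinate subspace [F^I], with coordinates in increasing order. *)
Definition coord_incl n m (I : {set 'I_n}) : 'M[F]_(n, m) :=
  \matrix_(i, j) (onth (enum I) j == Some i)%:R.

Lemma coord_projE n (I : {set 'I_n}) i j :
  coord_proj I i j = (i == j)%:R * (i \in I)%:R.
Proof. by rewrite !mxE mulr_natl; case: eqP => [->|]. Qed.

Lemma mul_coord_proj n k (I : {set 'I_n}) (A : 'M[F]_(n, k)) i j :
  (coord_proj I *m A) i j = (i \in I)%:R * A i j.
Proof. by rewrite mul_diag_mx !mxE. Qed.

Lemma mul_proj_coord n k (I : {set 'I_n}) (A : 'M[F]_(k, n)) i j :
  (A *m coord_proj I) i j = A i j * (j \in I)%:R.
Proof. by rewrite mul_mx_diag !mxE. Qed.

Lemma coord_projK n (I : {set 'I_n}) : coord_proj I *m coord_proj I = coord_proj I.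
Proof.
apply/matrixP=> i j; rewrite mul_coord_proj coord_projE.
by case: (i \in I); rewrite ?mul1r ?mulr1 ?mulr0 ?mul0r.
Qed.

(** [f] is the increasing enumeration of [I]; its monotonicity is what makes compression to [I] and
    extension from [I] preserve triangularity. *)
Lemma coord_inclP n m (I : {set 'I_n}) : #|I| = m ->
  exists f : 'I_m -> 'I_n,
    [/\ (forall i j, coord_incl m I i j = (f j == i)%:R) /\
        (forall i j, (coord_incl m I)^T j i = (f j == i)%:R),
        forall a b : 'I_m, (a < b)%N -> (f a < f b)%N,
        injective f & forall i, i \in I <-> exists j, f j = i].
Proof.
move=> Im; pose f j := enum_val (cast_ord (esym Im) j).
have onth_f (j : 'I_m) : onth (enum I) j = Some (f j).
  have jI : (j < size (enum I))%N by rewrite -cardE Im.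
  have -> : f j = nth (f j) (enum I) j by rewrite {1}/f (enum_val_nth (f j)).
  by rewrite onthE (nth_map (f j)).
have srt : sorted (relpre val ltn) (enum I).
  rewrite {1}/enum_mem; apply: sorted_filter => [x y z|]; first exact: ltn_trans.
  by rewrite -sorted_map -enumT val_enum_ord iota_ltn_sorted.
have inj_f : injective f by move=> a b /enum_val_inj/cast_ord_inj.
exists f; split=> // [|a b ab|i].
- by split=> i j; rewrite !mxE onth_f.
- rewrite /f !(enum_val_nth (f a)) /=.
  have tr : transitive (relpre (@nat_of_ord n) ltn) by move=> x y z; exact: ltn_trans.
  by apply: (sorted_ltn_nth tr) => //; rewrite inE -cardE Im.
- split=> [iI|[j <-]]; last exact: enum_valP.
  by exists (cast_ord Im (enum_rank_in iI i)); rewrite /f cast_ordK enum_rankK_in.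
Qed.

Lemma coord_inclTK n m (I : {set 'I_n}) :
  #|I| = m -> (coord_incl m I)^T *m coord_incl m I = 1%:M.
Proof.
case/coord_inclP=> f [[E ET] _ inj_f _]; apply/matrixP=> a b.
rewrite mxE [RHS]mxE (bigD1 (f a)) //= big1 ?addr0 => [|i ia].
  by rewrite ET E eqxx mul1r (inj_eq inj_f) eq_sym.
by rewrite ET eq_sym (negPf ia) mul0r.
Qed.

Lemma coord_inclKT n m (I : {set 'I_n}) :
  #|I| = m -> coord_incl m I *m (coord_incl m I)^T = coord_proj I.
Proof.
case/coord_inclP=> f [[E ET] _ inj_f fI]; apply/matrixP=> i j.
rewrite coord_projE mxE; case: (boolP (i \in I)) => [/fI[a <-]|nI].
  rewrite (bigD1 a) //= big1 ?addr0 => [|b ba]; first by rewrite ET E eqxx mul1r mulr1.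
  by rewrite E (inj_eq inj_f) (negPf ba) mul0r.
rewrite mulr0 big1 // => a _; rewrite E; case: eqP => [ai|]; last by rewrite mul0r.
by case/negP: nI; apply/fI; exists a.
Qed.

Lemma coord_proj_incl n m (I : {set 'I_n}) :
  #|I| = m -> coord_proj I *m coord_incl m I = coord_incl m I.
Proof. by move=> Im; rewrite -(coord_inclKT Im) -mulmxA coord_inclTK ?mulmx1. Qed.

Lemma coord_inclT_proj n m (I : {set 'I_n}) :
  #|I| = m -> (coord_incl m I)^T *m coord_proj I = (coord_incl m I)^T.
Proof. by move=> Im; rewrite -(coord_inclKT Im) mulmxA coord_inclTK ?mul1mx. Qed.

Lemma upper_tri_compress n m (I : {set 'I_n}) (b : 'M[F]_n) : #|I| = m ->
  upper_tri b -> upper_tri ((coord_incl m I)^T *m b *m coord_incl m I).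
Proof.
case/coord_inclP=> f [[E ET] homo_f _ _] tb i j ji.
rewrite mxE big1 // => l _; rewrite E; case: eqP => [<-|]; last by rewrite mulr0.
rewrite mxE big1 ?mul0r // => k _; rewrite ET.
by case: eqP => [<-|]; [rewrite tb ?homo_f // mulr0 | rewrite mul0r].
Qed.

(** Lifts the Borel group of [F^I] to that of [F^n], acting trivially on the other coordinates. *)
Lemma inB_expand n m (I : {set 'I_n}) (b : 'M[F]_m) : #|I| = m -> inB b ->
  inB (coord_incl m I *m b *m (coord_incl m I)^T + (1%:M - coord_proj I)).
Proof.
move=> Im Bb; case: (coord_inclP Im) => f [[E ET] homo_f inj_f fI].
have entry a a' :
    (coord_incl m I *m b *m (coord_incl m I)^T) (f a) (f a') = b a a'.
  rewrite mxE (bigD1 a') //= big1 ?addr0 => [|k ka].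
    rewrite ET eqxx mulr1 mxE (bigD1 a) //= big1 ?addr0 => [|k ka].
      by rewrite E eqxx mul1r.
    by rewrite E (inj_eq inj_f) (negPf ka) mul0r.
  by rewrite ET (inj_eq inj_f) (negPf ka) mulr0.
have entry0 i j : ~~ ((i \in I) && (j \in I)) ->
    (coord_incl m I *m b *m (coord_incl m I)^T) i j = 0.
  rewrite negb_and => ij; rewrite mxE big1 // => k _; rewrite mxE.
  rewrite ET; case: eqP => [fj|]; last by rewrite mulr0.
  rewrite big1 ?mul0r // => l _; rewrite E; case: eqP => [fi|]; last by rewrite mul0r.
  by case/orP: ij => /negP[]; apply/fI; [exists l | exists k].
set N := _ *m _ *m _ in entry entry0 *.
have EN i j : (N + (1%:M - coord_proj I)) i j =
    N i j + (i == j)%:R * (i \notin I)%:R.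
  rewrite mxE [X in _ + X]mxE [X in _ + (_ + X)]mxE coord_projE.
  by rewrite [1%:M i j]mxE; case: (i \in I); rewrite ?mulr1 ?mulr0 ?subrr ?subr0.
apply: inBP => [i j ji|i]; rewrite EN.
  rewrite -val_eqE gtn_eqF // mul0r addr0.
  have [/andP[/fI[a fa] /fI[a' fa']]|/entry0//] := boolP ((i \in I) && (j \in I)).
  rewrite -fa -fa' entry; apply: Bb.2.
  rewrite ltnNge; apply/negP; rewrite leq_eqVlt => /orP[/eqP/val_inj aa'|/homo_f].
    by rewrite -fa -fa' aa' ltnn in ji.
  by rewrite fa fa'; lia.
have [iI|niI] := boolP (i \in I).
  by have [a <-] := (fI i).1 iI; rewrite entry mulr0 addr0 inB_diag.
by rewrite entry0 ?(negPf niI) // eqxx mul1r add0r oner_neq0.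
Qed.

Lemma expand_incl n m (I : {set 'I_n}) (b : 'M[F]_m) : #|I| = m ->
  (coord_incl m I *m b *m (coord_incl m I)^T + (1%:M - coord_proj I))
    *m coord_incl m I = coord_incl m I *m b.
Proof.
move=> Im; rewrite mulmxDl mulmxBl mul1mx coord_proj_incl // subrr addr0 -mulmxA.
by rewrite coord_inclTK // mulmx1.
Qed.

(** The hypothesis says that [b] preserves the kernel of the projection, so compression is the
    action on the quotient and the compression of [invmx b] inverts it. *)
Lemma inB_compress_ker n m (I : {set 'I_n}) (b : 'M[F]_n) : #|I| = m -> inB b ->
  coord_proj I *m b *m coord_proj I = coord_proj I *m b ->
  inB ((coord_incl m I)^T *m b *m coord_incl m I).
Proof.
move=> Im [ub tb] EbE; split; last exact: upper_tri_compress.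
set N := coord_incl m I.
have /mulmx1_unit[] // : N^T *m b *m N *m (N^T *m invmx b *m N) = 1%:M.
rewrite !mulmxA -(mulmxA _ N) coord_inclKT // -(coord_inclT_proj Im) -/N.
rewrite -(mulmxA N^T) -(mulmxA N^T) EbE -!mulmxA (mulmxA b) mulmxV // mul1mx.
by rewrite mulmxA coord_inclT_proj // coord_inclTK.
Qed.

(** Dual situation: [b] preserves [F^I] itself and compression is restriction. *)
Lemma inB_compress_im n m (I : {set 'I_n}) (b : 'M[F]_n) : #|I| = m -> inB b ->
  coord_proj I *m b *m coord_proj I = b *m coord_proj I ->
  inB ((coord_incl m I)^T *m b *m coord_incl m I).
Proof.
move=> Im [ub tb] EbE; split; last exact: upper_tri_compress.
set N := coord_incl m I.
have /mulmx1_unit[] // : N^T *m invmx b *m N *m (N^T *m b *m N) = 1%:M.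
have bN : N *m (N^T *m b *m N) = b *m N.
  rewrite !mulmxA coord_inclKT // -[in LHS](coord_proj_incl Im : _ *m N = N).
  by rewrite mulmxA EbE -mulmxA coord_proj_incl.
by rewrite -mulmxA bN !mulmxA -(mulmxA N^T) mulVmx // mulmx1 coord_inclTK.
Qed.

End Coordinates.

(** * Echelon forms under triangular row operations *)

Section Echelon.
Variable F : fieldType.

Lemma coord_proj_cons n (e : bool) (I : {set 'I_n}) :
  exists I' : {set 'I_(1 + n)},
    coord_proj F I' = block_mx e%:R%:M 0 0 (coord_proj F I).
Proof.
exists [set i | match split i with inl _ => e | inr j => j \in I end].
apply/matrixP=> i j; rewrite coord_projE inE.
case: (split_ordP i) => i' ->; case: (split_ordP j) => j' ->;
  rewrite ?block_mxEul ?block_mxEur ?block_mxEdl ?block_mxEdr.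
- by rewrite !ord1 mxE !eqxx mul1r.
- by rewrite eq_lrshift mul0r mxE.
- by rewrite eq_rlshift mul0r mxE.
- by rewrite (inj_eq (@rshift_inj _ _)) coord_projE.
Qed.

(** A generalized inverse of a row, with [e] telling whether the row is nonzero; zero and pivot rows
    are then eliminated by the same formulas. *)
Lemma row_pinv k (r : 'rV[F]_k) : exists (z : 'cV_k) (e : bool),
  [/\ r *m z = e%:R%:M, r *m z *m r = r & z *m r *m z = z].
Proof.
have [->|/rV0Pn[j rj]] := eqVneq r 0.
  by exists 0, false; split; rewrite ?mulmx0 ?raddf0.
exists ((r 0 j)^-1 *: delta_mx j 0), true; set z := _ *: _.
have rz : r *m z = 1%:M.
  apply/matrixP=> a b; rewrite -scalemxAr -colE !ord1 !mxE.
  by rewrite mulVf.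
by rewrite rz -mulmxA rz mul1mx mulmx1.
Qed.

(** The last two conditions together say that the column space of [b *m C] is exactly [F^I]. The
    proof is forward elimination, each row being used to clear the rows below it. *)
Lemma lower_echelon n k (C : 'M[F]_(n, k)) :
  exists (I : {set 'I_n}) (b : 'M_n) (Z : 'M_(k, n)),
    [/\ b \in unitmx, is_trig_mx b,
        coord_proj F I *m (b *m C) = b *m C & b *m C *m Z = coord_proj F I].
Proof.
elim: n C => [|n IH] C.
  exists set0, 1%:M, 0; split; rewrite ?unitmx1 ?scalar_mx_is_trig //.
  - by apply/matrixP=> -[].
  - by apply/matrixP=> -[].
rewrite -[C](@vsubmxK _ 1 n); set r := usubmx _; set C1 := dsubmx _.
have [z [e [rz rzr zrz]]] := row_pinv r.
(* This makes the remaining rows vanish on [z], so that later pivots do not interfere with that of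
   [r]. *)
pose C' := C1 - C1 *m z *m r.
have [I1 [b1 [Z1 [ub1 tb1 EC CZ]]]] := IH C'.
have [I EI] := coord_proj_cons e I1.
pose b : 'M_(1 + n) := block_mx 1%:M 0 (- (b1 *m C1 *m z)) b1.
have bC : b *m col_mx r C1 = col_mx r (b1 *m C').
  by rewrite mul_block_col mul1mx mul0mx addr0 mulmxBr addrC mulNmx !mulmxA.
have Cz : b1 *m C' *m z = 0.
  by rewrite -mulmxA mulmxBl -!mulmxA [z *m _]mulmxA zrz subrr mulmx0.
have ECb : coord_proj F I *m (b *m col_mx r C1) = b *m col_mx r C1.
  by rewrite bC EI mul_block_col !mul0mx addr0 add0r EC -rz rzr.
(* The correction [z *m r *m Z1] makes [r] annihilate the second block, and it is invisible to
   [b1 *m C'], which kills [z]. *)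
have CbZ : b *m col_mx r C1 *m row_mx z (Z1 - z *m r *m Z1) = coord_proj F I.
  rewrite bC EI mul_col_row rz (mulmxBr r) (mulmxBr (b1 *m C')) !mulmxA rzr subrr Cz.
  by rewrite !mul0mx subr0 CZ.
exists I, b, (row_mx z (Z1 - z *m r *m Z1)); split => //.
- by rewrite unitmxE (@det_lblock _ 1 n) det1 mul1r -unitmxE.
- by rewrite (@is_trig_block_mx _ 1 n 1 n) // eqxx scalar_mx_is_trig.
Qed.

(** Conjugation by the order-reversing permutation matrix [w] exchanges lower and upper triangular
    matrices. *)
Lemma upper_echelon n k (C : 'M[F]_(n, k)) :
  exists (I : {set 'I_n}) (b : 'M_n) (Z : 'M_(k, n)),
    [/\ inB b, coord_proj F I *m (b *m C) = b *m C &
        b *m C *m Z = coord_proj F I].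
Proof.
pose w : 'M[F]_n := \matrix_(i, j) (j == rev_ord i)%:R.
have wE A i j : (w *m A *m w) i j = A (rev_ord i) (rev_ord j) :> F.
  rewrite mxE (bigD1 (rev_ord j)) //= big1 ?addr0 => [|l lj].
    rewrite [w _ _]mxE rev_ordK eqxx mulr1 mxE (bigD1 (rev_ord i)) //= big1 ?addr0.
      by rewrite mxE eqxx mul1r.
    by move=> l li; rewrite mxE (negPf li) mul0r.
  by rewrite [w _ _]mxE -(inj_eq rev_ord_inj) rev_ordK eq_sym (negPf lj) mulr0.
have ww : w *m w = 1%:M.
  apply/matrixP=> i j; have := wE 1%:M i j; rewrite mulmx1 => ->.
  by rewrite !mxE (inj_eq rev_ord_inj).
have [I [b [Z [ub tb EC CZ]]]] := lower_echelon (w *m C).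
have EI : coord_proj F [set i | rev_ord i \in I] = w *m coord_proj F I *m w.
  by apply/matrixP=> i j; rewrite wE !coord_projE inE (inj_eq rev_ord_inj).
exists [set i | rev_ord i \in I], (w *m b *m w), (Z *m w); rewrite EI; split.
- split; first by rewrite !unitmx_mul ub (mulmx1_unit ww).1.
  by move=> i j ji; rewrite wE; apply: (is_trig_mxP tb) => /=; have := ltn_ord i; lia.
- rewrite -!mulmxA (mulmxA w w) ww mul1mx.
  by congr (w *m _); rewrite mulmxA -[RHS]EC !mulmxA.
- by rewrite -CZ !mulmxA.
Qed.

End Echelon.

(** * Siegel double cosets and their invariants *)

Section SiegelDoubleCosets.
Variables (F : fieldType) (c : {rmorphism F -> F}).
Hypothesis cK : involutive c.
Variables (e : F) (n : nat).
Hypothesis e_neq0 : e != 0.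

Local Notation J := (e *: Sigma F n).
Local Notation adj := (adjc c).
Local Notation E := (coord_proj F).

Lemma scaled_Sigma_unit : J \in unitmx.
Proof.
rewrite unitmxZ ?unitfE //.
have SS : Sigma F n *m - Sigma F n = 1%:M.
  rewrite mulmxN mulmx_block !mul0mx !mulmx0 !mulmxN !mulmx1.
  by rewrite !addr0 !add0r opp_block_mx !opprK oppr0 -scalar_mx_block.
exact: (mulmx1_unit SS).1.
Qed.

(** As [J] is invertible, the form identity itself supplies a left inverse of [g]. *)
Lemma inG_form (g : 'M[F]_(n + n)) : adj g *m J *m g = J -> inG c J g.
Proof.
move=> gJ; split=> //.
have /mulmx1_unit[] // : (invmx J *m adj g *m J) *m g = 1%:M.
by rewrite -!mulmxA [adj g *m _]mulmxA gJ mulVmx // scaled_Sigma_unit.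
Qed.

Lemma inG1 : inG c J 1%:M.
Proof. by apply: inG_form; rewrite adjc1 mul1mx mulmx1. Qed.

Lemma inGM g h : inG c J g -> inG c J h -> inG c J (g *m h).
Proof.
move=> [_ gJ] [_ hJ]; apply: inG_form.
by rewrite adjcM -!mulmxA (mulmxA J) (mulmxA (adj g)) (mulmxA (adj g)) gJ mulmxA.
Qed.

Lemma inGV g : inG c J g -> inG c J (invmx g).
Proof.
move=> [ug gJ]; apply: inG_form; rewrite -{1}gJ adjcV.
by rewrite !mulmxA mulVmx ?adjc_unit // mul1mx -mulmxA mulmxV // mulmx1.
Qed.

Lemma inG_block (A B C D : 'M[F]_n) :
  inG c J (block_mx A B C D) <->
  [/\ adj A *m C = adj C *m A, adj A *m D - adj C *m B = 1%:M &
      adj B *m D = adj D *m B].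
Proof.
have gE : adj (block_mx A B C D) *m J *m block_mx A B C D = e *:
    block_mx (adj A *m C - adj C *m A) (adj A *m D - adj C *m B)
             (adj B *m C - adj D *m A) (adj B *m D - adj D *m B).
  rewrite -scalemxAr -scalemxAl adjc_block !mulmx_block.
  rewrite !mulmx0 !mulmxN !mulmx1 !addr0 !add0r !mulNmx.
  by congr (_ *: block_mx _ _ _ _); rewrite addrC.
split=> [[_]|[AC AD BD]].
  rewrite gE => /(scalerI e_neq0)/eq_block_mx[AC AD _ BD].
  by split=> //; apply/eqP; rewrite -subr_eq0 ?AC ?BD.
apply: inG_form; rewrite gE; congr (_ *: block_mx _ _ _ _) => //.
- by rewrite AC subrr.
(* The lower-left block equation is minus the adjoint of the upper-right one. *)
- apply: (can_inj (@adjcK _ c cK n n)).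
  by rewrite adjcN adjc1 -AD adjcB !adjcM !(adjcK cK) opprB.
- by rewrite BD subrr.
Qed.

Lemma inPE g : inP c J g <-> inG c J g /\ dlsubmx g = 0.
Proof.
rewrite -[in X in X <-> _](submxK g) -[in X in _ <-> X /\ _](submxK g).
split=> -[Gg Pg]; split=> //.
  apply/matrixP=> i j; have [w] := Pg (delta_mx j 0).
  rewrite mul_block_col => /eq_col_mx[_].
  by rewrite mulmx0 addr0 -colE => /matrixP/(_ i 0); rewrite !mxE.
move=> v; exists (ulsubmx g *m v).
by rewrite mul_block_col !mulmx0 !addr0 Pg mul0mx.
Qed.

Lemma inPM p q : inP c J p -> inP c J q -> inP c J (p *m q).
Proof.
move=> [Gp Pp] [Gq Pq]; split; first exact: inGM.
move=> v; have [w Ew] := Pq v; have [w' Ew'] := Pp w.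
by exists w'; rewrite -mulmxA Ew.
Qed.

Lemma inP_ulunit p : inP c J p -> ulsubmx p \in unitmx.
Proof.
case/inPE=> [[up _] p0]; move: up; rewrite -{1}(submxK p) p0 unitmxE det_ublock.
by rewrite unitrM => /andP[].
Qed.

Lemma inPV p : inP c J p -> inP c J (invmx p).
Proof.
move=> Pp; have /inPE[Gp p0] := Pp; apply/inPE; split; first exact: inGV.
have : invmx p *m p = 1%:M by rewrite mulVmx //; case: Gp.
move: (invmx p) => X; rewrite -{1}(submxK X) -{1}(submxK p).
rewrite mulmx_block scalar_mx_block p0.
rewrite !mulmx0 !addr0 => /eq_block_mx[_ _ X0 _].
by rewrite -[LHS](mulmxK (inP_ulunit Pp)) X0 mul0mx.
Qed.

Lemma HelM (a b : 'M[F]_n) : a \in unitmx -> b \in unitmx ->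
  Hel c (a *m b) = Hel c a *m Hel c b.
Proof.
move=> ua ub; rewrite /Hel mulmx_block !mulmx0 !mul0mx !addr0 !add0r.
by rewrite adjcM invmxM ?adjc_unit.
Qed.

Lemma Hel1 : Hel c 1%:M = 1%:M :> 'M[F]_(n + n).
Proof. by rewrite /Hel adjc1 invmx1 -scalar_mx_block. Qed.

Lemma HelV (a : 'M[F]_n) : a \in unitmx -> Hel c (invmx a) *m Hel c a = 1%:M.
Proof. by move=> ua; rewrite -HelM ?unitmx_inv // mulVmx // Hel1. Qed.

Lemma Hel_inG (a : 'M[F]_n) : a \in unitmx -> inG c J (Hel c a).
Proof.
move=> ua; apply/inG_block; split; rewrite ?adjc0 ?mulmx0 ?mul0mx ?subr0 //.
by rewrite mulmxV // adjc_unit.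
Qed.

Lemma relDC_sym g g' : relDC c J g g' -> relDC c J g' g.
Proof.
move=> [_ [p [[b [Bb ->]] Pp ->]]].
exists (Hel c (invmx b)), (invmx p); split; last 1 first.
- rewrite !mulmxA HelV ?(Bb.1) // mul1mx mulmxK //.
  by case: Pp => -[].
- by exists (invmx b); split=> //; exact: inBV.
- exact: inPV.
Qed.

Lemma relDC_trans g g' g'' :
  relDC c J g g' -> relDC c J g' g'' -> relDC c J g g''.
Proof.
move=> [_ [p [[b [Bb ->]] Pp ->]]] [_ [q [[d [Bd ->]] Pq ->]]].
exists (Hel c (d *m b)), (p *m q); split.
- by exists (d *m b); split=> //; exact: inBM.
- exact: inPM.
- by rewrite HelM ?(Bb.1) ?(Bd.1) // !mulmxA.
Qed.

(** Since [p] is block upper triangular, it changes the first [n] columns only by a change of basis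
    [u] of the Lagrangian they span. *)
Lemma relDC_block (A B C D A' B' C' D' : 'M[F]_n) :
  relDC c J (block_mx A B C D) (block_mx A' B' C' D') ->
  exists b u, [/\ inB b, u \in unitmx, b *m A = A' *m u &
                  invmx (adj b) *m C = C' *m u].
Proof.
move=> [_ [p [[b [Bb ->]] Pp Eg]]].
have Pp' := inPV Pp; have [[up _] _] := (inPE _).1 Pp'.
have [_ p0] := (inPE _).1 Pp'.
exists b, (ulsubmx (invmx p)); rewrite inP_ulunit //.
have : Hel c b *m block_mx A B C D = block_mx A' B' C' D' *m invmx p.
  by rewrite Eg mulmxK // -unitmx_inv.
rewrite -[in RHS](submxK (invmx p)) p0 !mulmx_block !mulmx0 !mul0mx !addr0 !add0r.
by move=> /eq_block_mx[-> _ -> _].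
Qed.

(** Converse: the two block equations say that [invmx g' *m Hel c b *m g], an element of [G],
    preserves the first summand, hence lies in the parabolic. *)
Lemma relDC_blockW (A B C D A' B' C' D' : 'M[F]_n) b u :
  inG c J (block_mx A B C D) -> inG c J (block_mx A' B' C' D') ->
  inB b -> b *m A = A' *m u -> invmx (adj b) *m C = C' *m u ->
  relDC c J (block_mx A B C D) (block_mx A' B' C' D').
Proof.
set g := block_mx A B C D; set g' := block_mx A' B' C' D' => Gg Gg' Bb bA bC.
apply: relDC_sym; exists (Hel c (invmx b)), (invmx g' *m Hel c b *m g); split.
- by exists (invmx b); split=> //; exact: inBV.
- split; first by apply: inGM => //; apply: inGM; [exact: inGV | exact: Hel_inG Bb.1].
  move=> v; exists (u *m v).
  have -> : invmx g' *m Hel c b *m g *m col_mx v 0 =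
      invmx g' *m (g' *m col_mx (u *m v) 0).
    rewrite -!mulmxA; congr (_ *m _).
    rewrite /g /g' !mul_block_col !mulmx0 !mul0mx !addr0 add0r.
    by rewrite !mulmxA bA bC.
  by rewrite mulKmx //; case: Gg'.
- by rewrite !mulmxA mulmxK ?HelV ?mul1mx //; case: Gg' => //; case: Bb.
Qed.

(** The first [n] columns span the Lagrangian [{(S w + w', w)}], [w] in [F^I] and
    [w'] in the complementary coordinate subspace. *)
Definition siegel_rep (I : {set 'I_n}) (S : 'M[F]_n) : 'M[F]_(n + n) :=
  block_mx (S + (1%:M - E I)) (- E I) (E I) (1%:M - E I).

Lemma adjc_proj (I : {set 'I_n}) : adj (E I) = E I.
Proof.
apply/matrixP=> i j; rewrite adjcE !coord_projE rmorphM !rmorph_nat.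
by rewrite eq_sym; case: eqP => [->|]; rewrite ?mul0r.
Qed.

Lemma adjc_incl m (I : {set 'I_n}) : adj (coord_incl F m I) = (coord_incl F m I)^T.
Proof. by apply/matrixP=> i j; rewrite adjcE !mxE rmorph_nat. Qed.

Lemma adjc_inclT m (I : {set 'I_n}) : adj (coord_incl F m I)^T = coord_incl F m I.
Proof. by rewrite -adjc_incl (adjcK cK). Qed.

Lemma siegel_rep_inG I S : adj S = S -> E I *m S = S -> inG c J (siegel_rep I S).
Proof.
move=> hS ES; have SE : S *m E I = S by rewrite -hS -(adjc_proj I) -adjcM ES.
have EE := coord_projK F I.
have PE : (1%:M - E I) *m E I = 0 by rewrite mulmxBl mul1mx EE subrr.
have EP : E I *m (1%:M - E I) = 0 by rewrite mulmxBr mulmx1 EE subrr.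
apply/inG_block; rewrite !adjcD !adjcN hS adjc1 !adjc_proj; split.
- by rewrite mulmxDl mulmxDr SE PE ES EP.
- rewrite mulmxDl (mulmxBr S) mulmx1 SE subrr add0r mulmxN EE opprK.
  by rewrite mulmxBl mul1mx EP subr0 subrK.
- by rewrite mulNmx EP mulmxN PE.
Qed.

(** Compare diagonal entries at an index of [I] outside [I']: one side gives [A i i], the other 0.
    This is the uniqueness of pivot positions, used for both [I] and [K]. *)
Lemma coord_proj_sub (I I' : {set 'I_n}) (A B : 'M[F]_n) :
  (forall i, A i i != 0) -> A *m E I = E I' *m B -> I \subset I'.
Proof.
move=> dA AE; apply/subsetP=> i iI; apply/negPn/negP=> niI'.
have /matrixP/(_ i i)/eqP := AE.
by rewrite mul_proj_coord mul_coord_proj iI (negPf niI') mulr1 mul0r (negPf (dA i)).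
Qed.

Lemma siegel_rep_sub I I' S S' :
  relDC c J (siegel_rep I S) (siegel_rep I' S') -> I \subset I'.
Proof.
case/relDC_block=> b [u [Bb _ _ bE]]; apply: coord_proj_sub bE => i.
by rewrite -adjcV adjcE fmorph_eq0 inB_diag //; exact: inBV.
Qed.

Lemma siegel_rep_set I I' S S' :
  relDC c J (siegel_rep I S) (siegel_rep I' S') -> I = I'.
Proof.
move=> r; apply/eqP.
by rewrite eqEsubset (siegel_rep_sub r) (siegel_rep_sub (relDC_sym r)).
Qed.

(** The lower blocks force [adj b] to preserve [F^I], so [b] preserves its complement and compresses
    to a Borel element; the upper blocks then relate the forms through this compression. *)
Lemma siegel_rep_congr m (I : {set 'I_n}) (h h' : 'M[F]_m) : #|I| = m ->
  let N := coord_incl F m I in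
  relDC c J (siegel_rep I (N *m h *m N^T)) (siegel_rep I (N *m h' *m N^T)) ->
  exists2 b, inB b & h' = b *m h *m adj b.
Proof.
move=> Im N; set S := N *m h *m N^T; set S' := N *m h' *m N^T.
have EE := coord_projK F I.
have EN : E I *m N = N by exact: coord_proj_incl.
have NE : N^T *m E I = N^T by exact: coord_inclT_proj.
have NN : N^T *m N = 1%:M by exact: coord_inclTK.
have SE : S *m E I = S by rewrite /S -mulmxA NE.
have SE' : S' *m E I = S' by rewrite /S' -mulmxA NE.
have ES' : E I *m S' = S' by rewrite /S' !mulmxA EN.
have PE : (1%:M - E I) *m E I = 0 by rewrite mulmxBl mul1mx EE subrr.
have EP : E I *m (1%:M - E I) = 0 by rewrite mulmxBr mulmx1 EE subrr.
case/relDC_block=> b [u [Bb uu bA bE]].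
have ub : adj b \in unitmx by rewrite adjc_unit; case: Bb.
have bE' : adj b *m E I = E I *m invmx u.
  by rewrite -[RHS](mulKVmx ub) (mulmxA (invmx _)) bE mulmxK.
have EbE : E I *m adj b *m E I = adj b *m E I by rewrite -mulmxA bE' mulmxA EE.
have EbE' : E I *m b *m E I = E I *m b.
  by apply: (can_inj (@adjcK _ c cK n n)); rewrite !adjcM adjc_proj mulmxA.
exists (N^T *m b *m N); first exact: inB_compress_ker.
(* Multiplying the upper blocks by [E I] on both sides removes the [1%:M - E I] parts; [u] is then
   eliminated through [bE]. *)
have EbS : E I *m b *m S = S' *m invmx (adj b) *m E I.
  have AE : (S + (1%:M - E I)) *m E I = S by rewrite mulmxDl SE PE addr0.
  have EA : E I *m (S' + (1%:M - E I)) = S' by rewrite mulmxDr ES' EP addr0.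
  rewrite -[in LHS]AE mulmxA -(mulmxA _ b) bA mulmxA EA -[in LHS]SE' -(mulmxA S') -bE.
  by rewrite -!mulmxA EE.
have S'E : S' = E I *m b *m S *m adj b *m E I.
  by rewrite EbS -mulmxA -(mulmxA _ (E I)) (mulmxA (E I)) EbE !mulmxA mulmxKV.
have hS : h' = N^T *m S' *m N by rewrite /S' !mulmxA NN mul1mx -mulmxA NN mulmx1.
rewrite hS S'E !adjcM /S !mulmxA NE -!mulmxA EN.
rewrite -[N^T](adjc_incl m I) (adjcK cK) adjc_incl.
by [].
Qed.
End SiegelDoubleCosets.

(** * Existence of Siegel representatives *)

Section SiegelRepresentatives.
Variables (F : fieldType) (c : {rmorphism F -> F}).
Hypothesis cK : involutive c.
Variables (e : F) (n : nat).
Hypothesis e_neq0 : e != 0.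

Local Notation J := (e *: Sigma F n).
Local Notation adj := (adjc c).
Local Notation E := (coord_proj F).

Lemma incl_form_inG m (I : {set 'I_n}) (h : 'M[F]_m) : #|I| = m -> adj h = h ->
  inG c J (siegel_rep I (coord_incl F m I *m h *m (coord_incl F m I)^T)).
Proof.
move=> Im hh; apply: siegel_rep_inG => //; last by rewrite !mulmxA coord_proj_incl.
by rewrite !adjcM hh -!(adjc_incl c) (adjcK cK) mulmxA.
Qed.

Lemma siegel_rep_congrW m (I : {set 'I_n}) (h b : 'M[F]_m) :
  #|I| = m -> adj h = h -> inB b -> let N := coord_incl F m I in
  relDC c J (siegel_rep I (N *m h *m N^T))
            (siegel_rep I (N *m (b *m h *m adj b) *m N^T)).
Proof.
move=> Im hh Bb N.
have EE := coord_projK F I.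
have EN : E I *m N = N by exact: coord_proj_incl.
have NE : N^T *m E I = N^T by exact: coord_inclT_proj.
have PE : (1%:M - E I) *m E I = 0 by rewrite mulmxBl mul1mx EE subrr.
have EP : E I *m (1%:M - E I) = 0 by rewrite mulmxBr mulmx1 EE subrr.
have NP : N^T *m (1%:M - E I) = 0 by rewrite mulmxBr mulmx1 NE subrr.
pose B := N *m b *m N^T + (1%:M - E I).
have BB : inB B by exact: inB_expand.
have BN : B *m N = N *m b by exact: expand_incl.
have BP : B *m (1%:M - E I) = 1%:M - E I.
  rewrite mulmxDl -mulmxA NP mulmx0 add0r mulmxBr mulmx1 PE subr0 //.
have uB : adj B \in unitmx by rewrite adjc_unit; case: BB.
have EB : E I *m adj B = adj B *m E I.
  rewrite adjcD adjcB adjc1 adjc_proj !adjcM -(adjc_incl c) (adjcK cK) (adjc_incl c).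
  by rewrite mulmxDl mulmxDr PE EP !addr0 -!mulmxA NE !mulmxA EN.
clearbody B.
have EBV : E I *m invmx (adj B) = invmx (adj B) *m E I.
  by rewrite -[LHS](mulKmx uB) (mulmxA (adj B)) -EB -mulmxA mulmxV // mulmx1.
have NB : adj b *m N^T *m invmx (adj B) = N^T.
  have -> : adj b *m N^T = N^T *m adj B by rewrite -(adjc_incl c) -!adjcM BN.
  by rewrite mulmxK.
(* The change of basis is the inverse of [adj B] on [F^I] and the identity on the complement, where
   [B] is the identity too. *)
apply: (@relDC_blockW _ _ cK _ _ e_neq0 _ _ _ _ _ _ _ _ B
  (invmx (adj B) *m E I + (1%:M - E I))) => //.
- exact: incl_form_inG.
- by apply: incl_form_inG; rewrite // !adjcM (adjcK cK) hh mulmxA.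
- set P := 1%:M - E I in PE NP BP *.
  have PP : P *m P = P by rewrite mulmxBr mulmx1 PE subr0.
  have PV : P *m (invmx (adj B) *m E I) = 0 by rewrite -EBV mulmxA PE mul0mx.
  have -> (S Q : 'M_n) : S *m P = 0 -> P *m Q = 0 -> (S + P) *m (Q + P) = S *m Q + P.
    by move=> SP PQ; rewrite mulmxDl !(mulmxDr _ Q) SP PQ PP addr0 add0r.
  - rewrite mulmxDr BP; congr (_ + _).
    by rewrite -!mulmxA (mulmxA N^T) (mulmxA (adj b)) (mulmxA (adj b)) NB NE !mulmxA BN.
  - by rewrite -(mulmxA _ N^T) NP mulmx0.
  - exact: PV.
- by rewrite mulmxDr EP addr0 mulmxA EBV -mulmxA EE.
Qed.

(** [Hel c b] acts on the second summand by [invmx (adj b)], so an upper triangular [b] amounts to a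
    lower triangular row operation [d] on [C]; echelon reduction of [C] turns the projection of the
    Lagrangian into [F^I]. *)
Lemma siegel_rep_exists g : inG c J g ->
  exists (I : {set 'I_n}) (h : 'M[F]_#|I|),
    adj h = h /\ relDC c J g
      (siegel_rep I (coord_incl F _ I *m h *m (coord_incl F _ I)^T)).
Proof.
rewrite -(submxK g); move: (ulsubmx g) (ursubmx g) (dlsubmx g) (drsubmx g).
move=> A B C D Gg; have [AC _ _] := (inG_block cK e_neq0 _ _ _ _).1 Gg.
have [I [d [Z [ud td EC CZ]]]] := lower_echelon C.
have Bd : inB (invmx (adj d)).
  apply: inBV; split; first by rewrite adjc_unit.
  by move=> i j ji; rewrite adjcE (is_trig_mxP td) // rmorph0.
set b := invmx (adj d) in Bd; 
have [X XE] : exists X, X = b *m A by eexists.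
have [Y YE] : exists Y, Y = d *m C by eexists.
rewrite -YE in EC CZ.
have bd : invmx (adj b) = d by rewrite -adjcV invmxK (adjcK cK).
have XY : adj X *m Y = adj Y *m X.
  rewrite XE YE !adjcM -!mulmxA (mulmxA (adj b)) (mulmxA (adj d)) /b mulmxV ?adjc_unit //.
  by rewrite mul1mx -AC adjcV (adjcK cK) mulVmx // mul1mx.
(* [S] is the Gram matrix [Z^* X^* Y Z] of the form induced on [F^I]. *)
pose S := adj Z *m adj X *m E I.
have SE : S *m E I = S by rewrite /S -mulmxA coord_projK.
have hS : adj S = S.
  rewrite /S -CZ !adjcM !(adjcK cK) !mulmxA; congr (_ *m _).
  by rewrite -!mulmxA XY.
have ES : E I *m S = S by rewrite -(adjc_proj c) -{1}hS -adjcM SE.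
(* Here isotropy enters: [E I] is replaced by [adj Z *m adj Y], and [XY] exchanges [X] and [Y]. *)
have EX : E I *m X = S *m Y.
  rewrite -(adjc_proj c) -{1}CZ adjcM -mulmxA -XY /S -!mulmxA.
  by rewrite EC.
clearbody S; pose N := coord_incl F #|I| I.
have NS : N *m (N^T *m S *m N) *m N^T = S.
  by rewrite !mulmxA coord_inclKT // ES -mulmxA coord_inclKT.
exists I, (N^T *m S *m N); rewrite NS; split.
  by rewrite !adjcM hS -(adjc_incl c) (adjcK cK) mulmxA.
(* The witness works since [S *m Y] recovers [E I *m X], while the second term supplies the
   complementary part of [X] and is killed by [E I]. *)
apply: (@relDC_blockW _ _ cK _ _ e_neq0 _ _ _ _ _ _ _ _ b (Y + (1%:M - E I) *m X)) => //.
- exact: siegel_rep_inG.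
- have PX : S *m ((1%:M - E I) *m X) = 0 by rewrite mulmxA mulmxBr mulmx1 SE subrr mul0mx.
  have PY : (1%:M - E I) *m Y = 0 by rewrite mulmxBl mul1mx EC subrr.
  have PP : (1%:M - E I) *m (1%:M - E I) = 1%:M - E I.
    by rewrite mulmxBr mulmx1 mulmxBl mul1mx coord_projK subrr subr0.
  rewrite -XE mulmxDr (mulmxDl _ _ Y) PY addr0 -EX (mulmxDl S) PX add0r mulmxA PP.
  by rewrite mulmxBl mul1mx addrC subrK.
- rewrite bd -YE mulmxDr mulmxA mulmxBr mulmx1 coord_projK subrr mul0mx addr0.
  by rewrite EC.
Qed.
End SiegelRepresentatives.

(** * Diagonalization of hermitian forms and Sylvester's law *)

Section HermitianForms.
Variables (F : numFieldType) (c : {rmorphism F -> F}).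
Hypothesis cK : involutive c.
Hypothesis mulc_ge0 : forall x : F, 0 <= x * c x.
Hypothesis fixc_norm : forall x : F, c x = x ->
  exists y, x = y * c y \/ x = - (y * c y).

Local Notation adj := (adjc c).
Local Notation E := (coord_proj F).

Lemma mul_Dpq m p q (x1 : 'M[F]_(m, p)) (x2 : 'M_(m, q)) :
  row_mx x1 x2 *m Dpq F p q *m adj (row_mx x1 x2) = x1 *m adj x1 - x2 *m adj x2.
Proof.
rewrite adjc_row mul_row_block !mulmx0 addr0 add0r mulmx1 mulmxN mulmx1.
by rewrite mul_row_col mulNmx.
Qed.

Lemma DpqK p q : Dpq F p q *m Dpq F p q = 1%:M.
Proof.
rewrite mulmx_block !mulmx0 !mul0mx mulmx1 mulmxN mulNmx mulmx1 opprK !addr0 add0r.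
by rewrite -scalar_mx_block.
Qed.

Lemma adjc_Dpq p q : adj (Dpq F p q) = Dpq F p q.
Proof. by rewrite adjc_block adjcN !adjc0 !adjc1. Qed.

(** Passes to the convention suited to Gram matrices [x *m Dpq F p q *m adj x]. As [Dpq] is an
    involution, a one-sided inverse can be read from either side. *)
Lemma Upq_adjP p q (u : 'M[F]_(p + q)) :
  inUpq c u <-> u \in unitmx /\ u *m Dpq F p q *m adj u = Dpq F p q.
Proof.
have swap (v : 'M[F]_(p + q)) : v \in unitmx ->
    v *m Dpq F p q *m adj v = Dpq F p q -> adj v *m Dpq F p q *m v = Dpq F p q.
  move=> uv vD.
  have /mulmx1C : v *m Dpq F p q *m (adj v *m Dpq F p q) = 1%:M by rewrite mulmxA vD DpqK.
  rewrite !mulmxA => /(congr1 (mulmx^~ (Dpq F p q))) /=.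
  by rewrite -(mulmxA _ _ (Dpq F p q)) DpqK mulmx1 mul1mx.
split=> -[uu uD]; split=> //; last exact: swap.
by have := swap (adj u); rewrite adjc_unit (adjcK cK); apply.
Qed.

Lemma adjc_sqr_eq0 p q (v : 'rV[F]_p) (w : 'rV[F]_q) :
  v *m adj v = - (w *m adj w) -> v = 0.
Proof.
have sqE k (x : 'rV[F]_k) : (x *m adj x) 0 0 = \sum_j x 0 j * c (x 0 j).
  by rewrite mxE; apply: eq_bigr => j _; rewrite adjcE.
have ge0 k (x : 'rV[F]_k) : 0 <= \sum_j x 0 j * c (x 0 j) by exact: sumr_ge0.
move/matrixP/(_ 0 0)/eqP; rewrite [fun_of_matrix (- _) _ _]mxE -addr_eq0 !sqE.
rewrite paddr_eq0 ?ge0 // => /andP[/eqP v0 _]; apply/rowP=> j; rewrite mxE.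
have /eqP : v 0 j * c (v 0 j) = 0 by apply: psumr_eq0P v0 _ _ => // i _.
by rewrite mulf_eq0 fmorph_eq0 orbb => /eqP.
Qed.

(** One half of the law of inertia: the positive rows of [z] have independent components in the
    positive part of the target, and likewise for the negative ones. *)
Lemma Dpq_signature_le p q p' q' (z : 'M[F]_(p + q, p' + q')) :
  z *m Dpq F p' q' *m adj z = Dpq F p q -> (p <= p')%N /\ (q <= q')%N.
Proof.
rewrite -(hsubmxK z) mul_Dpq -(vsubmxK (lsubmx z)) -(vsubmxK (rsubmx z)).
move: (usubmx (lsubmx z)) (dsubmx (lsubmx z)) (usubmx (rsubmx z)) (dsubmx (rsubmx z)).
move=> z11 z21 z12 z22.
have adj_col m1 m2 k (A : 'M[F]_(m1, k)) (B : 'M_(m2, k)) :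
    adj (col_mx A B) = row_mx (adj A) (adj B).
  by rewrite /adjc map_col_mx tr_col_mx.
rewrite !adj_col !mul_col_row opp_block_mx add_block_mx => /eq_block_mx[Ep _ _ Eq].
(* A row [v] killed by [B] satisfies [v v^* = - (v A) (v A)^*], so it vanishes. *)
have free k l r (A : 'M[F]_(k, l)) (B : 'M_(k, r)) :
    B *m adj B - A *m adj A = 1%:M -> (k <= r)%N.
  move=> AB; have /eqP <- : row_free B; last exact: rank_leq_col.
  apply: inj_row_free => v vB; apply: (@adjc_sqr_eq0 _ _ _ (v *m A)).
  rewrite -[adj v in LHS]mul1mx -AB mulmxBl mulmxBr !mulmxA vB !mul0mx sub0r.
  by rewrite adjcM mulmxA.
split; first exact: free Ep.
by apply: (free _ _ _ z21); rewrite -[RHS]opprK -Eq opprB.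
Qed.

Lemma hermitian_anisotropic r (h : 'M[F]_r) : adj h = h -> h != 0 ->
  exists v : 'rV_r, (v *m h *m adj v) 0 0 != 0.
Proof.
move=> hh h0.
have entry (a b : 'I_r) :
    ((delta_mx 0 a : 'rV_r) *m h *m adj (delta_mx 0 b : 'rV_r)) 0 0 = h a b.
  have -> : adj (delta_mx 0 b : 'rV_r) = delta_mx b 0.
    by apply/matrixP=> i j; rewrite adjcE !mxE rmorph_nat andbC.
  by rewrite -rowE -colE !mxE.
have [i [j hij]] : exists i j, h i j != 0.
  case: (pickP (fun ij : 'I_r * 'I_r => h ij.1 ij.2 != 0)) => [[i j] hij|hz].
    by exists i, j.
  case/eqP: h0; apply/matrixP=> i j; rewrite mxE.
  by have /negbFE/eqP := hz (i, j).
(* If both diagonal entries vanish, scaling [e_i] so that the cross term becomes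
   [1] gives [v h v^* = 1 + c 1 = 2]. *)
have [hii|hii] := eqVneq (h i i) 0; last by exists (delta_mx 0 i); rewrite entry.
have [hjj|hjj] := eqVneq (h j j) 0; last by exists (delta_mx 0 j); rewrite entry.
exists ((h i j)^-1 *: delta_mx 0 i + delta_mx 0 j).
have addE (A B : 'M[F]_1) : (A + B) 0 0 = A 0 0 + B 0 0 by rewrite mxE.
have scaleE a (A : 'M[F]_1) : (a *: A) 0 0 = a * A 0 0 by rewrite mxE.
rewrite adjcD !mulmxDl !mulmxDr adjcZ -!scalemxAl -!scalemxAr.
rewrite !(addE, scaleE, entry) hii hjj -[h j i](congr1 (fun M : 'M_r => M j i) hh).
rewrite adjcE fmorphV mulVf // mulVf ?fmorph_eq0 // !mulr0 add0r addr0.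
by rewrite -(natrD _ 1 1) pnatr_eq0.
Qed.

(** Induction on the rank: subtracting a suitable signed square [w *m adj w] puts an anisotropic
    vector into the kernel. The bound on [p + q] is what later makes the matrix of squares
    square. *)
Lemma hermitian_diff_squares r (h : 'M[F]_r) : adj h = h ->
  exists p q (x1 : 'M_(r, p)) (x2 : 'M_(r, q)),
    h = x1 *m adj x1 - x2 *m adj x2 /\ (p + q <= \rank h)%N.
Proof.
have [k] := ubnP (\rank h); elim: k h => // k IH h hk hh.
have [->|h0] := eqVneq h 0.
  by exists 0, 0, 0, 0; rewrite !mul0mx subr0.
have [v vhv] := hermitian_anisotropic hh h0.
set d := (v *m h *m adj v) 0 0 in vhv.
have dE : v *m h *m adj v = d%:M by rewrite [LHS]mx11_scalar.
have cd : c d = d.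
  have vh : adj (v *m h *m adj v) = v *m h *m adj v.
    by rewrite !adjcM hh (adjcK cK) mulmxA.
  by rewrite /d -{2}vh adjcE.
have [y [s ds]] : exists y (s : bool), d = (-1) ^+ s * (y * c y).
  by have [y [->|->]] := fixc_norm cd; exists y; [exists false | exists true];
    rewrite ?mul1r // mulN1r.
have y0 : y != 0 by apply: contraNneq vhv => y0; rewrite ds y0 mul0r mulr0.
(* Normalized so that [(-1) ^+ s *: (w *m adj w)] agrees with [h] on [adj v], because [d] is the
   signed norm of [y]. *)
pose w := y^-1 *: (h *m adj v).
have ww : w *m adj w = (y^-1 * (c y)^-1) *: (h *m adj v *m v *m h).
  by rewrite /w adjcZ adjcM hh (adjcK cK) -scalemxAl -scalemxAr scalerA fmorphV !mulmxA.
pose h' := h - (-1) ^+ s *: (w *m adj w).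
have hE : h = h' + (-1) ^+ s *: (w *m adj w) by rewrite subrK.
have h'v : h' *m adj v = 0.
  rewrite /h' ww scalerA mulmxBl -scalemxAl -!mulmxA (mulmxA v) dE mul_mx_scalar.
  rewrite -scalemxAr scalerA ds mulrACA -expr2 sqrr_sign mul1r mulrACA.
  rewrite !mulVf ?fmorph_eq0 // mulr1.
  by rewrite scale1r subrr.
have h'h : (h' <= h)%MS.
  apply/submxP; exists (1%:M - ((-1) ^+ s * (y^-1 * (c y)^-1)) *: (h *m adj v *m v)).
  by rewrite /h' ww scalerA mulmxBl mul1mx -scalemxAl.
(* The inclusion of row spaces is strict: [h'] kills [adj v], whereas [v *m h] does not. *)
have lt_h' : (\rank h' < \rank h)%N.
  suff: (h' < h)%MS by rewrite ltmxErank => /andP[].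
  rewrite /ltmx h'h; apply/negP=> /submxP[X hX]; case/eqP: vhv.
  by rewrite /d -mulmxA hX -mulmxA h'v !mulmx0 mxE.
have hh' : adj h' = h'.
  by rewrite /h' adjcB hh adjcZ rmorph_sign adjcM (adjcK cK).
clearbody h' w.
have [|p [q [x1 [x2 [h'E pq]]]]] := IH h' _ hh'; first exact: leq_trans lt_h' _.
have adj_row a b (A : 'M[F]_(r, a)) (B : 'M_(r, b)) :
    row_mx A B *m adj (row_mx A B) = A *m adj A + B *m adj B.
  by rewrite adjc_row mul_row_col.
case: s hE {ds} => hE.
  exists p, (1 + q)%N, x1, (row_mx w x2).
  split; last by rewrite addnCA (leq_ltn_trans pq).
  by rewrite hE h'E adj_row scaleN1r opprD addrA addrAC.
exists (1 + p)%N, q, (row_mx w x1), x2; split; last by rewrite -addnA (leq_ltn_trans pq).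
by rewrite hE h'E adj_row scale1r addrC addrA.
Qed.

(** Nondegeneracy gives [r <= p + q], since the rank is at most the number of squares. *)
Lemma hermitian_Dpq r (h : 'M[F]_r) : adj h = h -> h \in unitmx ->
  exists p q (x : 'M_(r, p + q)), (p + q)%N = r /\ h = x *m Dpq F p q *m adj x.
Proof.
move=> /hermitian_diff_squares[p [q [x1 [x2 [hE pq]]]]] uh.
exists p, q, (row_mx x1 x2); rewrite mul_Dpq; split=> //; apply/eqP.
rewrite eqn_leq (leq_trans pq) ?rank_leq_row //=.
have <- : \rank h = r by apply/eqP; rewrite -/(row_free h) row_free_unit.
rewrite {1}hE -mul_Dpq -mulmxA; apply: leq_trans (mxrankM_maxl _ _) _.
exact: rank_leq_col.
Qed.

End HermitianForms.

(** * Borel orbits of hermitian forms and the orbit bijections *)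

Section Classification.
Variables (F : numFieldType) (c : {rmorphism F -> F}).
Hypothesis cK : involutive c.
Hypothesis mulc_ge0 : forall x : F, 0 <= x * c x.
Hypothesis fixc_norm : forall x : F, c x = x ->
  exists y, x = y * c y \/ x = - (y * c y).

Local Notation adj := (adjc c).
Local Notation E := (coord_proj F).

Definition form_rep m p q (K : {set 'I_m}) (x : 'M[F]_(p + q)) : 'M[F]_m :=
  coord_incl F (p + q) K *m (x *m Dpq F p q *m adj x) *m (coord_incl F (p + q) K)^T.

Lemma form_rep_herm m p q (K : {set 'I_m}) (x : 'M[F]_(p + q)) :
  adj (form_rep K x) = form_rep K x.
Proof.
by rewrite /form_rep !adjcM -(adjc_incl c) !(adjcK cK) adjc_Dpq (adjc_incl c) !mulmxA.
Qed.

(** Exhibits [Dpq] as a pullback of the degenerate form, which lets signatures be compared by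
    [Dpq_signature_le]. *)
Lemma form_rep_invl m p q (K : {set 'I_m}) (x : 'M[F]_(p + q)) :
  #|K| = (p + q)%N -> x \in unitmx ->
  let L := invmx x *m (coord_incl F (p + q) K)^T in
  L *m form_rep K x *m adj L = Dpq F p q.
Proof.
rewrite /form_rep; set M := coord_incl F _ K => Kpq ux /=; set L := invmx x *m _.
have MM : M^T *m M = 1%:M by exact: coord_inclTK.
have -> : adj L = M *m invmx (adj x) by rewrite adjcM -(adjc_incl c) (adjcK cK) adjcV.
rewrite /L -!mulmxA (mulmxA M^T) MM mul1mx mulKmx // (mulmxA M^T) MM mul1mx.
by rewrite mulmxV ?mulmx1 ?adjc_unit.
Qed.

Lemma form_rep_signature_le m p q p' q' (K K' : {set 'I_m})
    (x : 'M[F]_(p + q)) (x' : 'M[F]_(p' + q')) (b : 'M[F]_m) :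
  #|K'| = (p' + q')%N -> x' \in unitmx ->
  form_rep K' x' = b *m form_rep K x *m adj b -> (p' <= p)%N /\ (q' <= q)%N.
Proof.
move=> Kpq ux' fE; have := form_rep_invl Kpq ux'; rewrite fE /=.
set L := invmx _ *m _ => LE.
apply: (@Dpq_signature_le _ _ mulc_ge0 _ _ _ _ (L *m b *m coord_incl F _ K *m x)).
rewrite -LE /form_rep !adjcM adjc_incl.
by rewrite !mulmxA.
Qed.

Lemma congr_form_inv m (h h' b : 'M[F]_m) : b \in unitmx ->
  h' = b *m h *m adj b -> h = invmx b *m h' *m adj (invmx b).
Proof.
move=> ub ->; rewrite adjcV -!mulmxA mulKmx // mulmxV ?adjc_unit //.
by rewrite mulmx1.
Qed.

Lemma form_rep_signature m p q p' q' (K K' : {set 'I_m})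
    (x : 'M[F]_(p + q)) (x' : 'M[F]_(p' + q')) (b : 'M[F]_m) :
  #|K| = (p + q)%N -> x \in unitmx -> #|K'| = (p' + q')%N -> x' \in unitmx ->
  b \in unitmx -> form_rep K' x' = b *m form_rep K x *m adj b -> p = p' /\ q = q'.
Proof.
move=> Kpq ux Kpq' ux' ub fE.
have [pp qq] := form_rep_signature_le Kpq' ux' fE.
have [pp' qq'] := form_rep_signature_le Kpq ux (congr_form_inv ub fE).
by split; lia.
Qed.

(** The column space of [form_rep K x] is [F^K], so [b] carries [F^K] into [F^K'] and triangularity
    gives [K = K']. With [d] the restriction of [b], both [x'] and [d *m x] are square roots of one
    Gram matrix, hence differ by an element of the unitary group. *)
Lemma form_rep_congr m p q (K K' : {set 'I_m}) (x x' : 'M[F]_(p + q)) (b : 'M[F]_m) :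
  #|K| = (p + q)%N -> #|K'| = (p + q)%N -> x \in unitmx -> x' \in unitmx -> inB b ->
  form_rep K' x' = b *m form_rep K x *m adj b ->
  K = K' /\ exists b' u, [/\ inB b', inUpq c u & x' = b' *m x *m u].
Proof.
move=> Kpq Kpq' ux ux' Bb fE.
pose M := coord_incl F (p + q) K; pose M' := coord_incl F (p + q) K'.
have [k kx] : exists k, k = x *m Dpq F p q *m adj x by eexists.
have uk : k \in unitmx.
  rewrite kx !unitmx_mul ux adjc_unit ux andbT.
  by case: (mulmx1_unit (DpqK F p q)).
have EM : E K = form_rep K x *m (M *m invmx k *m M^T).
  rewrite /form_rep -kx -/M -!mulmxA (mulmxA M^T) coord_inclTK // mul1mx.
  by rewrite (mulmxA k) mulmxV // mul1mx coord_inclKT.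
have EF' : form_rep K' x' = E K' *m form_rep K' x'.
  by rewrite /form_rep !mulmxA coord_proj_incl.
have ub : adj b \in unitmx by rewrite adjc_unit; case: Bb.
have bE : b *m E K = E K' *m
    (form_rep K' x' *m invmx (adj b) *m (M *m invmx k *m M^T)).
  rewrite EM; move: fE EF'; move: (form_rep K x) (form_rep K' x') => S S' fE EF'.
  by rewrite !mulmxA -EF' fE mulmxK.
have KK : K = K'.
  apply/eqP; rewrite eqEcard Kpq Kpq' leqnn andbT.
  by apply: coord_proj_sub bE => i; exact: inB_diag.
split=> //; subst K'.
have EbE : E K *m b *m E K = b *m E K.
  by rewrite -mulmxA bE mulmxA coord_projK.
pose d := M^T *m b *m M.
have Bd : inB d by exact: inB_compress_im.
have MF (y : 'M[F]_(p + q)) : M^T *m form_rep K y *m M = y *m Dpq F p q *m adj y.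
  by rewrite /form_rep !mulmxA coord_inclTK // mul1mx -!mulmxA coord_inclTK // mulmx1.
have kE : x' *m Dpq F p q *m adj x' = d *m x *m Dpq F p q *m adj (d *m x).
  rewrite -MF fE /form_rep /d !adjcM (adjc_incl c) -(adjc_incl c) (adjcK cK).
  by rewrite !mulmxA.
have udx : d *m x \in unitmx by rewrite unitmx_mul ux (Bd.1).
exists d, (invmx (d *m x) *m x'); split=> //; last by rewrite mulKVmx.
move: (d *m x) udx kE => y uy kE.
apply/(Upq_adjP cK); split; first by rewrite unitmx_mul unitmx_inv uy.
rewrite adjcM adjcV -(mulmxA (invmx y)) -mulmxA (mulmxA (x' *m _)) kE.
by rewrite -!mulmxA mulKmx // mulmxV ?mulmx1 // adjc_unit.
Qed.

Lemma form_rep_congrW m p q (K : {set 'I_m}) (x b u : 'M[F]_(p + q)) :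
  #|K| = (p + q)%N -> inB b -> inUpq c u ->
  exists2 b', inB b' & form_rep K (b *m x *m u) = b' *m form_rep K x *m adj b'.
Proof.
move=> Kpq Bb /(Upq_adjP cK)[uu uD].
set M := coord_incl F (p + q) K.
exists (M *m b *m M^T + (1%:M - E K)); first exact: inB_expand.
set B := _ + _; have BM : B *m M = M *m b by exact: expand_incl.
have MB : M^T *m adj B = adj b *m M^T by rewrite -(adjc_incl c) -!adjcM BM.
rewrite /form_rep -/M !mulmxA BM -!mulmxA MB !adjcM -{2}uD.
by rewrite !mulmxA.
Qed.

(** Row echelon form makes [F^K] the column space of [b *m h], hence of [b *m h *m adj b]; by
    hermitian symmetry this form lives on [F^K] on both sides, and its compression is invertible. *)
Lemma form_rep_exists m (h : 'M[F]_m) : adj h = h ->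
  exists p q (K : {set 'I_m}) (x : 'M[F]_(p + q)) (b : 'M[F]_m),
    [/\ #|K| = (p + q)%N, x \in unitmx, inB b & b *m h *m adj b = form_rep K x].
Proof.
move=> hh; have [K [b [Z [Bb EC CZ]]]] := upper_echelon h.
(* Naming the cardinal lets [p + q = r] be substituted later, so that [x] is square without a
   cast. *)
have [r Kr] : exists r, #|K| = r by eexists.
pose N := coord_incl F r K; pose h' := b *m h *m adj b.
have hh' : adj h' = h' by rewrite /h' !adjcM (adjcK cK) hh mulmxA.
have ub : adj b \in unitmx by rewrite adjc_unit; case: Bb.
have Eh : E K *m h' = h' by rewrite /h' mulmxA EC.
have hZ : h' *m (invmx (adj b) *m Z) = E K by rewrite mulmxA mulmxK.
have h'P : b *m h *m adj b = h' by [].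
clearbody h'.
have hE : h' *m E K = h' by rewrite -{1}hh' -(adjc_proj c) -adjcM Eh hh'.
pose k := N^T *m h' *m N.
have hk : adj k = k by rewrite /k !adjcM hh' (adjc_inclT cK) (adjc_incl c) mulmxA.
have uk : k \in unitmx.
  move: hZ; move: (invmx _ *m Z) => V hV.
  have /mulmx1_unit[] // : k *m (N^T *m V *m N) = 1%:M.
  rewrite /k -!mulmxA (mulmxA N) coord_inclKT // (mulmxA h' (E K)) hE (mulmxA h' V) hV.
  by rewrite coord_proj_incl // coord_inclTK.
have [p [q [x [pq kE]]]] := hermitian_Dpq cK fixc_norm hk uk.
have h'E : h' = N *m k *m N^T.
  by rewrite !mulmxA coord_inclKT // Eh -mulmxA coord_inclKT.
move: Kr; subst r => Kr; exists p, q, K, x, b; split=> //; last by rewrite h'P h'E kE.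
move: uk; rewrite kE !unitmx_mul => /andP[/andP[]] //.
Qed.

Variables (e : F) (n : nat).
Hypothesis e_neq0 : e != 0.
Local Notation J := (e *: Sigma F n).

(** Inverse of the bijection: a form supported on [F^K] in [F^m], transported to [F^I] in [F^n]. *)
Definition cop_rep (s : cop F n) : 'M[F]_(n + n) :=
  let N := coord_incl F (tag s).1.1 (tagged s).1.1 in
  siegel_rep (tagged s).1.1 (N *m form_rep (tagged s).1.2 (tagged s).2 *m N^T).

Lemma cop_rep_inG s : inCop s -> inG c J (cop_rep s).
Proof.
case: s => [[[m p] q] [[I K] x]] [/= _ _ Im _ _].
by apply: incl_form_inG => //; exact: form_rep_herm.
Qed.

Lemma cop_rep_congrW s s' : inCop s -> relCop c s s' ->
  relDC c J (cop_rep s) (cop_rep s').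
Proof.
move=> Cs r; case: r Cs => {s s'} m p q I K x b u Bb Uu [/= _ _ Im Kpq ux].
have [b' Bb' fE] := form_rep_congrW x Kpq Bb Uu.
rewrite /cop_rep /= fE.
by apply: siegel_rep_congrW => //; exact: form_rep_herm.
Qed.

(** The invariants are recovered in order of dependency: [I], then [m] as its cardinal, the
    signature, [K], and finally the class of [x]. *)
Lemma cop_rep_congr s s' : inCop s -> inCop s' ->
  relDC c J (cop_rep s) (cop_rep s') -> relCop c s s'.
Proof.
case: s s' => [[[m p] q] [[I K] x]] [[[m' p'] q'] [[I' K'] x']].
move=> [/= _ _ Im Kpq ux] [/= _ _ Im' Kpq' ux'] r.
have II := siegel_rep_set e_neq0 r; rewrite /= in II; subst I'.
have mm : m' = m by rewrite -Im -Im'.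
clear Im'; subst m'; have [b Bb fE] := siegel_rep_congr cK e_neq0 Im r.
have [pp qq] := form_rep_signature Kpq ux Kpq' ux' (Bb.1) fE.
subst p' q'; have [KK [b' [u [Bb' Uu ->]]]] := form_rep_congr Kpq Kpq' ux ux' Bb fE.
by subst K'; exact: RelCop.
Qed.

Lemma cop_rep_exists g : inG c J g -> exists2 s, inCop s & relDC c J g (cop_rep s).
Proof.
move=> /(siegel_rep_exists cK e_neq0)[I [h [hh gI]]].
have [p [q [K [x [b [Kpq ux Bb bE]]]]]] := form_rep_exists hh.
exists (existT (fun t : nat * nat * nat =>
  ({set 'I_n} * {set 'I_(t.1.1)} * 'M[F]_(t.1.2 + t.2))%type)
  (#|I|, p, q) (I, K, x)).
  split=> //=; first by rewrite -[X in (_ <= X)%N]card_ord max_card.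
  by rewrite -Kpq -[X in (_ <= X)%N]card_ord max_card.
apply: (relDC_trans e_neq0 gI); rewrite /cop_rep /= -bE.
exact: siegel_rep_congrW.
Qed.

Lemma orbit_bij_cop : orbit_bij (inG c J) (relDC c J) (@inCop F n) (@relCop F c n).
Proof.
have rep g : exists s, inG c J g -> inCop s /\ relDC c J g (cop_rep s).
  have [/cop_rep_exists[s Cs gs]|nG] := pselect (inG c J g); first by exists s.
  (* Arbitrary value outside [G], needed because the map is total on matrices. *)
  by exists (existT _ (0, 0, 0)%N (set0, set0, 0)).
have [f fP] := choice rep.
exists f; split.
- by move=> g /fP[].
- move=> g g' Gg Gg'; have [Cg gf] := fP g Gg; have [Cg' gf'] := fP g' Gg'.
  split=> [gg'|/(cop_rep_congrW Cg) ff'].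
    apply: cop_rep_congr => //; apply: (relDC_trans e_neq0 _ gf').
    exact: (relDC_trans e_neq0 (relDC_sym e_neq0 gf) gg').
  exact: (relDC_trans e_neq0 (relDC_trans e_neq0 gf ff') (relDC_sym e_neq0 gf')).
- move=> s Cs; exists (cop_rep s); split; first exact: cop_rep_inG.
  have [Cf rf] := fP _ (cop_rep_inG Cs).
  by apply: cop_rep_congr => //; exact: relDC_sym.
Qed.

(** Every [H]-orbit contains points whose first coset is that of 1, with stabilizer [B_H];
    translating there sends [(h, g)] to [invmx h *m g]. *)
Lemma orbit_bij_diagonal :
  orbit_bij (inX c J) (relX c J) (inG c J) (relDC c J).
Proof.
exists (fun x => invmx x.1 *m x.2).
have inGH (h : 'M_(n + n)) : inH c h -> inG c J h.
  by move=> [a [ua ->]]; exact: Hel_inG.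
have BH (b : 'M_(n + n)) : inBH c b -> inH c b by move=> [a [[ua _] ->]]; exists a.
have BHV (b : 'M_(n + n)) : inBH c b -> inBH c (invmx b).
  move=> [a [Ba ->]]; exists (invmx a); split; first exact: inBV.
  have uH : Hel c a \in unitmx by case: (Hel_inG cK e_neq0 Ba.1).
  by rewrite -[RHS](mulmxK uH) HelV ?mul1mx //; case: Ba.
have HM (h h' : 'M_(n + n)) : inH c h -> inH c h' -> inH c (h *m h').
  move=> [a [ua ->]] [a' [ua' ->]]; exists (a *m a'); rewrite unitmx_mul ua ua'.
  by rewrite HelM.
have HV (h : 'M_(n + n)) : inH c h -> inH c (invmx h).
  move=> [a [ua ->]]; exists (invmx a); rewrite unitmx_inv; split=> //.
  have uH : Hel c a \in unitmx by case: (Hel_inG cK e_neq0 ua).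
  by rewrite -[RHS](mulmxK uH) HelV ?mul1mx.
split=> [[h g] [/= Hh Gg]|[h g] [h' g'] [/= Hh Gg] [/= Hh' Gg']|g Gg].
- by apply: inGM => //; apply: inGV => //; exact: inGH.
- have uh : h \in unitmx by case: (inGH _ Hh).
  have uh' : h' \in unitmx by case: (inGH _ Hh').
  split=> [[k [b [p [Hk Bb Pp /= -> ->]]]]|[b [p [Bb Pp gE]]]].
    have uk : k \in unitmx by case: (inGH _ Hk).
    have ub : b \in unitmx by case: (inGH _ (BH _ Bb)).
    exists (invmx b), p; split=> //; first exact: BHV.
    by rewrite !invmxM ?unitmx_mul ?uk // !mulmxA mulmxKV.
  have ub : b \in unitmx by case: (inGH _ (BH _ Bb)).
  (* This element of [H] moves [h] to [h' *m b], which lies in the coset of [h']. *)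
  exists (h' *m b *m invmx h), (invmx b), p; split=> //=.
  + exact: HM _ _ (HM _ _ Hh' (BH _ Bb)) (HV _ Hh).
  + exact: BHV.
  + by rewrite mulmxKV // mulmxK.
  + by rewrite -[LHS](mulKVmx uh') gE !mulmxA.
- exists (1%:M, g); split.
    by split=> //; exists 1%:M; rewrite unitmx1 Hel1.
  exists 1%:M, 1%:M; rewrite /= invmx1 !mul1mx mulmx1; split=> //.
    by exists 1%:M; rewrite Hel1; split=> //; exact: inB1.
  by split; [exact: inG1 | move=> v; exists v; rewrite mul1mx].
Qed.

End Classification.

(** * The complex and real cases *)

Lemma conj_fix_norm (C : numClosedFieldType) (x : C) : x^* = x ->
  exists y, x = y * y^* \/ x = - (y * y^*).
Proof.
move=> /CrealP xR; exists (sqrtC `|x|).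
rewrite conj_Creal ?ger0_real ?sqrtC_ge0 // -expr2 sqrtCK.
by case: (real_ge0P xR) => _; [left | right; rewrite opprK].
Qed.

Theorem theorem1p7 (R : realType) (n : nat) :
  (* (1) Case (A): G = U(n,n), F = C = R[i], involution = complex conjugation,
         J_n = sqrt(-1) * Sigma_n *)
  (let JA : 'M[R[i]]_(n + n) := (sqrtC (-1 : R[i])) *: Sigma (R[i]) n in
   orbit_bij (inX (fun z : R[i] => z^*) JA) (relX (fun z : R[i] => z^*) JA)
             (inG (fun z : R[i] => z^*) JA) (relDC (fun z : R[i] => z^*) JA)
   /\ orbit_bij (inG (fun z : R[i] => z^*) JA) (relDC (fun z : R[i] => z^*) JA)
                (@inCop (R[i]) n) (@relCop (R[i]) (fun z : R[i] => z^*) n))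
  /\
  (* (2) Case (B): G = Sp_2n(R), F = R, involution = identity *)
  (let JB : 'M[R]_(n + n) := Sigma R n in
   orbit_bij (inX id JB) (relX id JB) (inG id JB) (relDC id JB)
   /\ orbit_bij (inG id JB) (relDC id JB) (@inCop R n) (@relCop R id n)).
Proof.
split.
- have conjCK : involutive (@Num.conj R[i]) by exact: conjCK.
  have sqrt_neq0 : sqrtC (-1 : R[i]) != 0 by rewrite sqrtC_eq0 oppr_eq0 oner_eq0.
  split; first exact: (orbit_bij_diagonal conjCK n sqrt_neq0).
  exact: (orbit_bij_cop conjCK (@mul_conjC_ge0 _) (@conj_fix_norm _) n sqrt_neq0).
- have idK : involutive (@idfun R) by [].
  (* The symplectic case is the general one with scalar [e = 1]. *)
  move=> JB; have -> : JB = 1 *: Sigma R n by rewrite scale1r.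
  split; first exact: (orbit_bij_diagonal idK n (oner_neq0 R)).
  apply: (orbit_bij_cop idK _ _ n (oner_neq0 R)) => [x|x _].
    by rewrite -expr2 sqr_ge0.
  exists (Num.sqrt `|x|); rewrite -expr2 sqr_sqrtr //.
  by case: (ger0P x) => _; [left | right; rewrite opprK].
Qed.
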